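(* Let $f:X\to X$ be a continuous map acting on a metric space $(X,d)$, with Zadeh extension $\hat f:\mathcal{F}(X)\to\mathcal{F}(X)$. If $(X,f)$ is contractive and the set $f^k(X)$ is bounded in $(X,d)$ for some $k\in\mathbb{N}$, then the three dynamical systems $((\mathcal{F}(X),d_0),\hat f)$, $((\mathcal{F}(X),d_S),\hat f)$ and $((\mathcal{F}(X),d_E),\hat f)$ have the shadowing property. In particular, the previous conclusion holds whenever $(X,f)$ is contractive and $(X,d)$ itself is bounded.
   Context: Write $\mathbb{I}=[0,1]$, $\mathbb{N}=\{1,2,\dots\}$. For a metric space $(X,d)$, the Hausdorff distance between non-empty closed sets $C_1,C_2\subset X$ is $d_H(C_1,C_2)=\max\{\sup_{x_1\in C_1}d(x_1,C_2),\sup_{x_2\in C_2}d(x_2,C_1)\}$, where $d(x,C)=\inf_{c\in C}d(x,c)$. Fuzzy sets: for $u:X\to\mathbb{I}$ set $u_\alpha=\{x: u(x)\ge\alpha\}$ for $\alpha\in(0,1]$ and $u_0=\overline{\{x:u(x)>0\}}$. $\mathcal{F}(X)$ (normal fuzzy sets) is the set of all upper-semicontinuous $u:X\to\mathbb{I}$ such that $u_0$ is compact and $u_1$ is non-empty. The Zadeh extension of a continuous $f:X\to X$ is $\hat f:\mathcal{F}(X)\to\mathcal{F}(X)$, $[\hat f(u)](x)=\sup\{u(y): y\in f^{-1}(\{x\})\}$ if $f^{-1}(\{x\})\neq\varnothing$ and $[\hat f(u)](x)=0$ otherwise (it is well defined). Metrics on $\mathcal{F}(X)$: $d_\infty(u,v)=\sup_{\alpha\in\mathbb{I}}d_H(u_\alpha,v_\alpha)$;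 the Skorokhod metric $d_0(u,v)$ is the infimum of all $\varepsilon>0$ for which there is a strictly increasing homeomorphism $\xi:\mathbb{I}\to\mathbb{I}$ with $\sup_{\alpha\in\mathbb{I}}|\xi(\alpha)-\alpha|\le\varepsilon$ and $d_\infty(u,\xi\circ v)\le\varepsilon$. On $X\times\mathbb{I}$ put $\overline d((x,\alpha),(y,\beta))=\max\{d(x,y),|\alpha-\beta|\}$, with Hausdorff distance $\overline d_H$. Let $\mathrm{end}(u)=\{(x,\alpha)\in X\times\mathbb{I}: u(x)\ge\alpha\}$ and $\mathrm{send}(u)=\mathrm{end}(u)\cap(u_0\times\mathbb{I})$. The endograph metric is $d_E(u,v)=\overline d_H(\mathrm{end}(u),\mathrm{end}(v))$ and the sendograph metric is $d_S(u,v)=\overline d_H(\mathrm{send}(u),\mathrm{send}(v))$. The map $\hat f$ is continuous for each of these metrics. $(X,f)$ is contractive if there is $\lambda\in[0,1)$ with $d(f(x),f(y))\le\lambda d(x,y)$ for all $x,y\in X$. Shadowing: let $g:Y\to Y$ be a continuous map on a metric space $(Y,r)$. An infinite sequence $(y_j)_{j=0}^\infty$ in $Y$ is an $r$-$\delta$-pseudo-trajectory if $r(g(y_j),y_{j+1})<\delta$ for all $j\ge0$; it is $r$-$\varepsilon$-shadowed by the $g$-orbit of $y\in Y$ if $r(g^j(y),y_j)<\varepsilon$ for all $j\ge0$. The system $(Y,g)$ has the shadowing property if for every $\varepsilon>0$ there is $\delta_\varepsilon>0$ such that every $r$-$\delta_\varepsilon$-pseudo-trajectory is $r$-$\varepsilon$-shadowed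 by the $g$-orbit of some point of $Y$. *)

(* Defs.v *)
From mathcomp Require Import all_boot all_order all_algebra.
From mathcomp Require Import all_classical all_reals all_analysis.

Set Implicit Arguments.
Unset Strict Implicit.
Unset Printing Implicit Defensive.

Import Order.TTheory GRing.Theory Num.Theory.
Import numFieldNormedType.Exports.

Local Open Scope classical_set_scope.
Local Open Scope ring_scope.

Section hausdorff_distance.
Context {R : realType} {T : Type}.
Variable d : T -> T -> R.

(* Suprema and infima are taken in \bar R, so that no junk value is attached to
   an unbounded set. *)
Definition dist_set (x : T) (C : set T) : \bar R :=
  ereal_inf [set (d x c)%:E | c in C].

Definition hausdorff_dist (C1 C2 : set T) : \bar R :=
  Order.max (ereal_sup [set dist_set x1 C2 | x1 in C1])
            (ereal_sup [set dist_set x2 C1 | x2 in C2]).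

End hausdorff_distance.

Section fuzzy_sets.
Context {R : realType} {X : metricType R}.
Implicit Types (u v : X -> R) (xi : R -> R).

Definition upper_semicontinuous u :=
  forall x a, u x < a -> \forall y \near x, u y < a.

(* u_a, for a in [0, 1] *)
Definition level u (a : R) : set X :=
  if a == 0 then closure [set x | 0 < u x] else [set x | a <= u x].

(* The distances below are defined for arbitrary functions X -> R and only used
   on fuzzy sets (and on xi \o v, with v a fuzzy set). *)
Definition d_infty u v : \bar R :=
  ereal_sup [set hausdorff_dist mdist (level u a) (level v a) | a in `[0, 1]].

(* Only the restriction of xi to [0, 1] is relevant. *)
Definition increasing_homeo01 xi :=
  [/\ set_fun `[0, 1] `[0, 1] xi,
      {in `[0, 1] &, {homo xi : a b / a < b}},
      {within `[0, 1], continuous xi} &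
      exists zeta : R -> R,
        [/\ set_fun `[0, 1] `[0, 1] zeta,
            {within `[0, 1], continuous zeta},
            {in `[0, 1], cancel xi zeta} &
            {in `[0, 1], cancel zeta xi}]].

Definition d_skorokhod u v : \bar R :=
  ereal_inf [set e%:E | e in [set e : R | 0 < e /\
    exists xi, [/\ increasing_homeo01 xi,
      (ereal_sup [set `|xi a - a|%:E | a in `[0%R, 1%R]] <= e%:E)%E &
      (d_infty u (xi \o v) <= e%:E)%E]]].

Definition prod_dist (p q : X * R) : R :=
  Num.max (mdist p.1 q.1) `|p.2 - q.2|.

Definition endograph u : set (X * R) :=
  [set p | p.2 \in `[0, 1] /\ p.2 <= u p.1].

Definition sendograph u : set (X * R) :=
  endograph u `&` (level u 0 `*` `[0, 1]).

Definition d_endograph u v : \bar R :=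
  hausdorff_dist prod_dist (endograph u) (endograph v).

Definition d_sendograph u v : \bar R :=
  hausdorff_dist prod_dist (sendograph u) (sendograph v).

Definition zadeh_fun (f : X -> X) u (x : X) : R :=
  if `[< f @^-1` [set x] !=set0 >] then sup [set u y | y in f @^-1` [set x]]
  else 0.

End fuzzy_sets.

Record normal_fuzzy {R : realType} (X : metricType R) := NormalFuzzy {
  fuzzy_fun :> X -> R ;
  fuzzy_itv : forall x, fuzzy_fun x \in `[0, 1] ;
  fuzzy_usc : upper_semicontinuous fuzzy_fun ;
  fuzzy_compact : compact (level fuzzy_fun 0) ;
  fuzzy_normal : level fuzzy_fun 1 !=set0
}.
Arguments fuzzy_itv {R X} u x : rename.
Arguments fuzzy_usc {R X} u x a : rename.
Arguments fuzzy_compact {R X} u : rename.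

Section zadeh_extension.
Context {R : realType} {X : metricType R}.
Variables (f : X -> X) (cf : continuous f).
Variable u : normal_fuzzy X.

Let g := zadeh_fun f u.

Let u01 x : 0 <= u x <= 1.
Proof. by have := fuzzy_itv u x; rewrite in_itv. Qed.

Let preim_has_sup x : f @^-1` [set x] !=set0 ->
  has_sup [set u y | y in f @^-1` [set x]].
Proof.
move=> [y fyx]; split; first by exists (u y), y.
by exists 1 => _ [z _ <-]; have /andP[] := u01 z.
Qed.

Let superlevel_closed a : closed [set x | a <= u x].
Proof.
rewrite -openC openE => x /= /negP; rewrite -ltNge => /(fuzzy_usc u _ _).
by apply: filterS => y uya /=; apply/negP; rewrite -ltNge.
Qed.

Let superlevel_compact a : 0 < a -> compact [set x | a <= u x].
Proof.
move=> a0.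
suff : [set x | a <= u x] `<=` level u 0.
  exact: subclosed_compact (@superlevel_closed a) (fuzzy_compact u).
rewrite /level eqxx => x /= ax; apply: subset_closure => /=.
exact: lt_le_trans ax.
Qed.

Let zadeh_attained a x : 0 < a -> a <= g x ->
  exists2 y, f y = x & a <= u y.
Proof.
move=> a0; rewrite /g /zadeh_fun; case: asboolP => [ne ag|_]; last first.
  by rewrite leNgt a0.
pose C b := [set y | b <= u y] `&` f @^-1` [set x].
have Cne b : b < a -> C b !=set0.
  move=> /lt_le_trans/(_ ag) /(sup_gt (preim_has_sup ne).1)[_ [y fy <-] by_].
  by exists y; split => //=; exact: ltW.
have Ccl b : closed (C b).
  apply: closedI; first exact: superlevel_closed.
  apply: preimage_closed => [y _|]; first exact: cf.
  by have /hausdorff_accessible/accessible_closed_set1 := @metric_hausdorff _ X.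
have FF : ProperFilter (filter_from [set b | b < a] C).
  apply: filter_from_proper => [|b /Cne//].
  apply: filter_from_filter; first by exists 0.
  move=> b c /= ba ca; exists (Num.max b c); first by rewrite gt_max ba ca.
  by move=> y [/=]; rewrite ge_max => /andP[bu cu] fy; split.
have a2a : a / 2 < a by rewrite ltr_pdivrMr// ltr_pMr// ltr1n.
have [|y [_ cly]] := @superlevel_compact (a / 2) (divr_gt0 a0 (ltr0Sn _ _)) _ FF.
  by exists (a / 2) => // y [].
have Cy b : b < a -> C b y.
  move=> ba; apply: Ccl => B By; apply: cly => //.
  by exists b.
exists y; first by have [] := Cy _ a2a.
rewrite leNgt; apply/negP => uya.
have [h _] := Cy _ (midf_lt uya).2.
by move: h; rewrite /= leNgt (midf_lt uya).1.
Qed.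

Let zadeh_ge y : u y <= g (f y).
Proof.
have ne : f @^-1` [set f y] !=set0 by exists y.
rewrite /g /zadeh_fun asboolT//.
apply: ub_le_sup; last by exists y.
by have [] := preim_has_sup ne.
Qed.

Let zadeh_superlevel a : 0 < a ->
  [set x | a <= g x] = f @` [set y | a <= u y].
Proof.
move=> a0; apply/seteqP; split => x /=.
  by move=> /(zadeh_attained a0)[y <- ay]; exists y.
by move=> [y ay <-]; exact: le_trans (zadeh_ge y).
Qed.

Let fcompact (K : set X) : compact K -> closed (f @` K) /\ compact (f @` K).
Proof.
move=> cK; have cfK : compact (f @` K).
  exact: continuous_compact (continuous_subspaceT cf) cK.
by split => //; exact: compact_closed (@metric_hausdorff _ X) cfK.
Qed.

Fact zadeh_itv x : zadeh_fun f u x \in `[0, 1].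
Proof.
rewrite in_itv /= /zadeh_fun; case: asboolP => [ne|_]; last by rewrite lexx ler01.
have [y fyx] := ne; have hs := preim_has_sup ne; apply/andP; split.
  apply: (@le_trans _ _ (u y)); first by have /andP[] := u01 y.
  by apply: ub_le_sup; [exact: hs.2|exists y].
by apply: ge_sup hs.1 _ => _ [z _ <-]; have /andP[] := u01 z.
Qed.

Fact zadeh_usc : upper_semicontinuous (zadeh_fun f u).
Proof.
move=> x a gxa; have a0 : 0 < a.
  by apply: le_lt_trans gxa; have := zadeh_itv x; rewrite in_itv => /andP[].
have : open (~` [set y | a <= g y]).
  rewrite openC zadeh_superlevel//.
  by have [] := fcompact (superlevel_compact a0).
rewrite openE => op; have : (~` [set y | a <= g y]) x.
  by apply/negP; rewrite -ltNge.
by move=> /op; apply: filterS => y /= /negP; rewrite -ltNge.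
Qed.

Fact zadeh_compact : compact (level (zadeh_fun f u) 0).
Proof.
have [cl co] := fcompact (fuzzy_compact u).
rewrite /level eqxx.
suff : closure [set x | 0 < g x] `<=` f @` level u 0.
  exact: (subclosed_compact (@closed_closure _ _) co).
rewrite [X in _ `<=` X](closure_id _).1//; apply: closureS => x /= gx.
move: (gx) => /zadeh_attained/(_ (lexx _))[y fyx uy].
exists y => //; rewrite /level eqxx; apply: subset_closure => /=.
exact: lt_le_trans uy.
Qed.

Fact zadeh_normal : level (zadeh_fun f u) 1 !=set0.
Proof.
have [y] := fuzzy_normal u; rewrite /level oner_eq0 /= => uy.
by exists (f y) => /=; exact: le_trans (zadeh_ge y).
Qed.

Definition zadeh : normal_fuzzy X :=
  NormalFuzzy zadeh_itv zadeh_usc zadeh_compact zadeh_normal.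

End zadeh_extension.

Section metric_maps.
Context {R : realType} {X : metricType R}.

Definition contractive (f : X -> X) :=
  exists2 lambda : R, 0 <= lambda < 1 &
    forall x y, mdist (f x) (f y) <= lambda * mdist x y.

Definition metric_bounded (A : set X) :=
  exists M : R, forall x y, A x -> A y -> mdist x y <= M.

End metric_maps.

Section shadowing.
Context {R : realType} {Y : Type}.
(* r is \bar R-valued because the distances above are; on normal fuzzy sets they
   only take finite values. *)
Variables (r : Y -> Y -> \bar R) (g : Y -> Y).

Definition pseudo_trajectory (delta : R) (y_ : nat -> Y) :=
  forall j, (r (g (y_ j)) (y_ j.+1) < delta%:E)%E.

Definition shadowed (eps : R) (y_ : nat -> Y) (y : Y) :=
  forall j, (r (iter j g y) (y_ j) < eps%:E)%E.

Definition shadowing_property :=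
  forall eps : R, 0 < eps -> exists2 delta : R, 0 < delta &
    forall y_, pseudo_trajectory delta y_ -> exists y, shadowed eps y_ y.

End shadowing.

(* Main.v *)
Require Import Defs.
From mathcomp Require Import all_boot all_order all_algebra.
From mathcomp Require Import all_classical all_reals all_analysis.

Import numFieldNormedType.Exports.
Import Order.TTheory GRing.Theory Num.Theory.
Local Open Scope classical_set_scope.
Local Open Scope ring_scope.

(** Write [g] for the Zadeh extension and [r] for any of the three metrics on
    fuzzy sets. Two facts give shadowing.

    - [g] does not expand [r], because [f] does not expand the distance of [X].
      Hence, in a [delta]-pseudo-trajectory, the errors committed in [n]
      consecutive steps add up to at most [n * delta].
    - The sets [f^n(X)] have diameters tending to 0: from the first bounded one
      on, each iteration multiplies the diameter by the contraction ratio. Every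
      level of [g^n(u)] lies in [f^n(X)], so [g^n] sends all fuzzy sets into a
      set of arbitrarily small [r]-diameter.

    Given [eps], fix [N] such that the diameter for [N] iterations is at most
    [eps / 2], and then [delta] with [N * delta < eps / 2]. The orbit of the
    first point [y_0] shadows: up to time [N] because the accumulated error is
    small, and at a later time [i + N] because [g^N(g^i(y_0))] and [g^N(y_i)]
    are both in the small set while [y_(i+N)] has drifted from [g^N(y_i)] during
    [N] steps only. This is [shadowing_of_vanishing_diameter].

    What remains is to transfer both facts from [X] to the three metrics, and
    everything there rests on the identity [level (g u) a = f @` level u a]
    ([level_zadeh]), a consequence of the compactness of the support. In terms
    of levels, a sendograph is the set of all pairs of a height and a point of
    the level at that height, and an endograph is a sendograph together with the
    floor [X * {0}]; so images of fuzzy sets under [g] become images of sets,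
    and [hausdorff_dist_image] and [hausdorff_dist_setU] apply. For the
    Skorokhod metric, changing heights by a homeomorphism only relabels the
    levels ([homeo01_level]), so the same homeomorphism serves before and after
    applying [g]. *)

(** * Shadowing for nonexpansive maps with shrinking images *)

Section shadowing_criterion.
Context {R : realType} {Y : Type}.
Variables (r : Y -> Y -> \bar R) (g : Y -> Y).
(* The metrics on fuzzy sets are extended-real infima and suprema; stating the
   metric axioms through real upper bounds avoids sums of infinities. *)
Hypothesis r_refl : forall x, (r x x <= 0%:E)%E.
Hypothesis r_triangle : forall x y z (a b : R),
  (r x y <= a%:E -> r y z <= b%:E -> r x z <= (a + b)%:E)%E.
Hypothesis g_nonexpansive : forall x y (a : R), 0 <= a ->
  (r x y <= a%:E -> r (g x) (g y) <= a%:E)%E.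

(** Each step adds a new error of at most [delta], while the errors already made
    are carried along by [g] without growing. *)
Lemma pseudo_trajectory_drift (delta : R) (y_ : nat -> Y) (j n : nat) :
  0 <= delta -> pseudo_trajectory r g delta y_ ->
  (r (iter n g (y_ j)) (y_ (n + j)%N) <= (delta *+ n)%:E)%E.
Proof.
move=> d0 ydelta; elim: n => [|n IHn]; first exact: r_refl.
rewrite mulrSr iterS addSn; apply: r_triangle (ltW (ydelta _)).
by apply: g_nonexpansive IHn; rewrite mulrn_wge0.
Qed.

(** Once [iter N g] has nearly forgotten its argument, shadowing is only a matter
    of the last [N] steps, where the drift is under control. *)
Lemma shadowing_of_vanishing_diameter :
  (forall eps : R, 0 < eps ->
    exists N, forall x y, (r (iter N g x) (iter N g y) <= eps%:E)%E) ->
  shadowing_property r g.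
Proof.
move=> vanish eps eps0; have eps20 : 0 < eps / 2 by rewrite divr_gt0.
have [N diamN] := vanish _ eps20.
exists (eps / 2 / N.+1%:R) => [|y_ ydelta]; first by rewrite divr_gt0.
set delta := _ / N.+1%:R in ydelta; have d0 : 0 < delta by rewrite divr_gt0.
have drift n : (n <= N)%N -> delta *+ n < eps / 2.
  move=> nN; rewrite /delta -mulr_natr mulrAC ltr_pdivrMr ?ltr0n//.
  by rewrite ltr_pM2l// ltr_nat ltnS.
(* After time [N] orbits have nearly forgotten their starting points, so it is
   enough that the orbit of [y_0] follows the first [N] steps. *)
exists (y_ 0%N) => j; have [jN|Nj] := leqP j N.
  have := pseudo_trajectory_drift _ _ 0 j (ltW d0) ydelta.
  rewrite addn0 => /le_lt_trans; apply; rewrite lte_fin.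
  by apply: lt_trans (drift _ jN) _; rewrite ltr_pdivrMr// ltr_pMr// ltr1n.
have -> : j = (N + (j - N))%N by rewrite subnKC// ltnW.
rewrite iterD; apply: le_lt_trans (r_triangle _ _ _ _ _ (diamN _ _) _) _.
  exact: pseudo_trajectory_drift (ltW d0) ydelta.
by rewrite lte_fin [ltRHS]splitr ltrD2l drift.
Qed.

End shadowing_criterion.

(** * Real upper bounds of Hausdorff distances *)

Section hausdorff.
Context {R : realType}.
Implicit Types (e : R).

(** The infimum defining the distance from a point to [B] need not be attained,
    hence the strict bounds [e'] above [e]. *)
Definition in_neighborhood {T : Type} (d : T -> T -> R) e (A B : set T) :=
  forall x, A x -> forall e', e < e' -> exists2 y, B y & d x y < e'.

(** Reduces all estimates below to choosing nearby points; no case distinction on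
    infinite distances or empty sets is left afterwards. *)
Lemma hausdorff_dist_leP {T : Type} (d : T -> T -> R) e (A B : set T) :
  (hausdorff_dist d A B <= e%:E)%E <->
  in_neighborhood d e A B /\ in_neighborhood d e B A.
Proof.
have half (C D : set T) :
    (ereal_sup [set dist_set d x D | x in C] <= e%:E)%E <->
    in_neighborhood d e C D.
  split=> [/ereal_supP supCD x Cx e' ee'|nCD].
    have : (dist_set d x D < e'%:E)%E.
      by apply: le_lt_trans (supCD _ _) _; [exists x|rewrite lte_fin].
    by move=> /ereal_inf_lt[_ [y Dy <-]]; rewrite lte_fin => dxy; exists y.
  apply/ereal_supP => _ [x Cx <-]; apply/lee_addgt0Pr => h h0.
  have [|y Dy dxy] := nCD x Cx (e + h); first by rewrite ltrDl.
  apply: ge_ereal_inf; exists (d x y)%:E; first by exists y.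
  by rewrite -EFinD lee_fin ltW.
rewrite /hausdorff_dist ge_max; split.
  by move=> /andP[/half ? /half ?].
by move=> [/half -> /half ->].
Qed.

Lemma hausdorff_dist_refl {T : Type} (d : T -> T -> R) (A : set T) :
  (forall x, d x x <= 0) -> (hausdorff_dist d A A <= 0%:E)%E.
Proof.
move=> dxx; apply/hausdorff_dist_leP.
by split=> x Ax e' e'0; exists x => //; exact: le_lt_trans (dxx x) e'0.
Qed.

Lemma hausdorff_dist_triangle {T : Type} (d : T -> T -> R) a b
    (A B C : set T) :
  (forall x y z, d x z <= d x y + d y z) ->
  (hausdorff_dist d A B <= a%:E -> hausdorff_dist d B C <= b%:E ->
   hausdorff_dist d A C <= (a + b)%:E)%E.
Proof.
move=> dtri.
have half a' b' (D E F : set T) : in_neighborhood d a' D E ->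
    in_neighborhood d b' E F -> in_neighborhood d (a' + b') D F.
  move=> nDE nEF x Dx e' abe'; have h0 : 0 < (e' - (a' + b')) / 2.
    by rewrite divr_gt0// subr_gt0.
  have [|y Ey dxy] := nDE x Dx (a' + (e' - (a' + b')) / 2); first by rewrite ltrDl.
  have [|z Fz dyz] := nEF y Ey (b' + (e' - (a' + b')) / 2); first by rewrite ltrDl.
  exists z => //; apply: le_lt_trans (dtri x y z) _.
  by apply: lt_le_trans (ltrD dxy dyz) _; rewrite addrACA -splitr subrKC.
move=> /hausdorff_dist_leP[AB BA] /hausdorff_dist_leP[BC CB].
apply/hausdorff_dist_leP; split; first exact: half AB BC.
by rewrite addrC; exact: half CB BA.
Qed.

Lemma hausdorff_dist_image {T U : Type} (d : T -> T -> R) (d' : U -> U -> R)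
    (phi : T -> U) e (A B : set T) :
  (forall x y, d' (phi x) (phi y) <= d x y) ->
  (hausdorff_dist d A B <= e%:E ->
   hausdorff_dist d' (phi @` A) (phi @` B) <= e%:E)%E.
Proof.
move=> phi1 /hausdorff_dist_leP[AB BA]; apply/hausdorff_dist_leP.
split=> _ [x Ax <-] e' ee'.
  have [y By dxy] := AB x Ax e' ee'.
  by exists (phi y); [exists y|exact: le_lt_trans dxy].
have [y By dxy] := BA x Ax e' ee'.
by exists (phi y); [exists y|exact: le_lt_trans dxy].
Qed.

(** A part common to both sets is at distance 0 from itself. This is how the floor
    of an endograph is dealt with. *)
Lemma hausdorff_dist_setU {T : Type} (d : T -> T -> R) e (A B C : set T) :
  (forall x, d x x <= 0) -> 0 <= e ->
  (hausdorff_dist d A B <= e%:E ->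
   hausdorff_dist d (A `|` C) (B `|` C) <= e%:E)%E.
Proof.
move=> dxx e0 /hausdorff_dist_leP[AB BA]; apply/hausdorff_dist_leP.
split=> x [Ax|Cx] e' ee'.
- by have [y By dxy] := AB x Ax e' ee'; exists y => //; left.
- exists x; [by right|exact: le_lt_trans (dxx x) (le_lt_trans e0 ee')].
- by have [y By dxy] := BA x Ax e' ee'; exists y => //; left.
- exists x; [by right|exact: le_lt_trans (dxx x) (le_lt_trans e0 ee')].
Qed.

End hausdorff.

(** * Levels and graphs of fuzzy sets *)

Lemma itv01_gt0_or_eq0 {R : realType} {a : R} :
  a \in `[0, 1] -> 0 < a \/ a = 0.
Proof.
rewrite in_itv/= => /andP[+ _]; rewrite le_eqVlt.
by move=> /predU1P[->|]; [right|left].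
Qed.

Section level_sets.
Context {R : realType} {X : metricType R}.
Implicit Types (u v w : normal_fuzzy X).

Lemma fuzzy_ge0 u x : 0 <= u x.
Proof. by have := fuzzy_itv u x; rewrite in_itv => /andP[]. Qed.

Lemma level_pos (w : X -> R) a : 0 < a -> level w a = [set x | a <= w x].
Proof. by move=> a0; rewrite /level gt_eqF. Qed.

Lemma level0 (w : X -> R) : level w 0 = closure [set x | 0 < w x].
Proof. by rewrite /level eqxx. Qed.

Lemma level_sub0 (w : X -> R) a :
  a \in `[0, 1] -> level w a `<=` level w 0.
Proof.
move=> /itv01_gt0_or_eq0[a0|-> //]; rewrite level_pos// level0 => x /= awx.
by apply: subset_closure; exact: lt_le_trans awx.
Qed.

Lemma level_neq0 u a : a \in `[0, 1] -> level u a !=set0.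
Proof.
move=> a01; have [x] := fuzzy_normal u; rewrite level_pos// => /= ux.
exists x; have [a0|->] := itv01_gt0_or_eq0 a01.
  rewrite level_pos//=; apply: le_trans ux.
  by move: a01; rewrite in_itv/= => /andP[].
rewrite level0; apply: subset_closure.
exact: lt_le_trans ux.
Qed.

(** Heights must be split into zero and positive ones: at height 0 the graph
    condition is void and belonging to the support is what counts, whereas a
    positive level is contained in the support. *)
Lemma sendographE u :
  sendograph u = [set p | p.2 \in `[0, 1] /\ level u p.2 p.1].
Proof.
apply/seteqP; split=> [[x a]|[x a]]; rewrite /sendograph /endograph/=.
  move=> [[a01 aux] [u0x _]]; split => //.
  have [a0|a0] := itv01_gt0_or_eq0 a01; first by rewrite level_pos.
  by rewrite a0 in u0x *.
move=> [a01 uax]; split; last by split => //; exact: level_sub0 uax.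
split => //; have [a0|->] := itv01_gt0_or_eq0 a01; last exact: fuzzy_ge0.
by move: uax; rewrite level_pos.
Qed.

(** Only at height 0 does an endograph contain points over the complement of the
    support. *)
Lemma endographE u : endograph u = sendograph u `|` [set p | p.2 = 0].
Proof.
rewrite sendographE; apply/seteqP; split=> [[x a]|[x a]]; rewrite /endograph/=.
  move=> [a01 aux]; have [a0|->] := itv01_gt0_or_eq0 a01; last by right.
  by left; split => //; rewrite level_pos.
case=> [uax|->]; last by rewrite in_itv/= lexx ler01 fuzzy_ge0.
have : sendograph u (x, a) by rewrite sendographE.
by case.
Qed.

(** The supremum over a fibre of [f] is attained. The sets [C b] of points of the
    fibre with value at least [b], for [b] below [a], form a filter base living
    in the compact support; a cluster point is still in the fibre by continuity
    of [f], and upper semicontinuity keeps its value from being below [a]. *)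
Lemma superlevel_attained {f : X -> X} {u} {a : R} {x : X} : continuous f -> 0 < a ->
  a <= zadeh_fun f u x -> exists2 y, f y = x & a <= u y.
Proof.
move=> cf a0; rewrite /zadeh_fun.
case: asboolP => [ne ax|_]; last by rewrite leNgt a0.
pose C b := [set y | f y = x /\ b <= u y].
have FC : ProperFilter (filter_from [set b | 0 < b < a] C).
  apply: filter_from_proper => [|b /andP[_ ba]].
    apply: filter_from_filter => [|b c /andP[b0 ba] /andP[c0 ca]].
      exists (a / 2); rewrite /= divr_gt0// ltr_pdivrMr// ltr_pMr// ltr1n//.
    exists (Num.max b c); first by rewrite /= lt_max gt_max b0 ba ca.
    by move=> y [fy]; rewrite ge_max => /andP[].
  have [|_ [y fy <-] buy] := sup_gt _ (lt_le_trans ba ax).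
    by have [y fy] := ne; exists (u y), y.
  by exists y; split => //; exact: ltW.
have [|y [_ cly]] := fuzzy_compact u _ FC.
  (* Heights in the filter base are positive, so that [C (a / 2)] is in the
     support. *)
  exists (a / 2); first by rewrite /= divr_gt0// ltr_pdivrMr// ltr_pMr// ltr1n//.
  move=> y [_ uy]; rewrite level0; apply: subset_closure.
  by apply: lt_le_trans uy; rewrite divr_gt0.
have clyC b B : 0 < b < a -> nbhs y B -> exists z, [/\ f z = x, b <= u z & B z].
  move=> b0a yB; have [|z [[? ?] ?]] := cly (C b) B _ yB; first by exists b.
  by exists z.
have a20 : 0 < a / 2 < a by rewrite divr_gt0// ltr_pdivrMr// ltr_pMr// ltr1n.
(* [f y] and [x] have no disjoint neighborhoods, hence are equal. *)
exists y.
  apply: (@metric_hausdorff _ X) => A B fyA xB.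
  have [z [fz _ Az]] := clyC _ _ a20 (cf y _ fyA).
  by exists (f z); split => //; rewrite fz; exact: nbhs_singleton xB.
(* If [u y] were below [a], then [u] would stay below their midpoint near [y],
   although [y] is a cluster point of the set where [u] is above it. *)
rewrite leNgt; apply/negP => uya.
have [um ma] := midf_lt uya.
have [|z [_ mz]] := clyC ((u y + a) / 2) _ _ (fuzzy_usc u _ _ um).
  by rewrite ma andbT; apply: le_lt_trans um; exact: fuzzy_ge0.
by rewrite ltNge mz.
Qed.

Lemma zadeh_fun_ge (f : X -> X) u y : u y <= zadeh_fun f u (f y).
Proof.
rewrite /zadeh_fun asboolT; last by exists y.
apply: ub_le_sup; last by exists y.
by exists 1 => _ [z _ <-]; have := fuzzy_itv u z; rewrite in_itv => /andP[].
Qed.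

(** At positive heights this is the attainment of suprema. At height 0, the image
    of the support is compact, hence closed, and contains all points of positive
    value; conversely, continuity maps a closure into the closure of the image.
    *)
Lemma level_zadeh (f : X -> X) (cf : continuous f) u a : a \in `[0, 1] ->
  level (zadeh cf u) a = f @` level u a.
Proof.
move=> /itv01_gt0_or_eq0[a0|->].
  rewrite !level_pos//; apply/seteqP; split=> [x /=|_ [y uy <-]/=].
    by move=> /(superlevel_attained cf a0)[y <- uy]; exists y.
  exact: le_trans (zadeh_fun_ge f u y).
apply/seteqP; split.
  have cfu : closed (f @` level u 0).
    apply: compact_closed; first exact: metric_hausdorff.
    exact: continuous_compact (continuous_subspaceT cf) (fuzzy_compact u).
  rewrite [X in _ `<=` X](closure_id _).1// level0; apply: closureS => x /= gx.
  have [y fy uy] := superlevel_attained cf gx (lexx _).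
  exists y => //; rewrite level0; apply: subset_closure.
  exact: lt_le_trans uy.
rewrite !level0 => _ [y cly <-] B /cf fyB.
have [z [/= uz Bz]] := cly _ fyB.
by exists (f z); split => //=; exact: lt_le_trans (zadeh_fun_ge f u z).
Qed.

Lemma level_iter_zadeh (f : X -> X) (cf : continuous f) n u a :
  a \in `[0, 1] ->
  level (iter n (zadeh cf) u) a = iter n f @` level u a.
Proof.
move=> a01; elim: n => [|n IHn]; first by rewrite image_id.
by rewrite iterS level_zadeh// IHn image_comp.
Qed.

End level_sets.

(** * Time changes of the unit interval *)

Section homeomorphisms.
Context {R : realType}.
Implicit Types (xi : R -> R).

(** Composing with an increasing homeomorphism permutes the levels, through its
    inverse [zeta]. As [xi] fixes 0, this includes the support, which is the
    closure of a strict superlevel set. *)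
Lemma homeo01_level {X : metricType R} {xi} : increasing_homeo01 xi ->
  exists zeta : R -> R, forall a, a \in `[0, 1] -> zeta a \in `[0, 1] /\
    forall w : X -> R, (forall x, w x \in `[0, 1]) ->
      level (xi \o w) a = level w (zeta a).
Proof.
move=> [xi01 xiM _ [zeta [zeta01 _ xiK zetaK]]]; exists zeta => a a01.
have xi_le := le_mono_in xiM; have xi_lt := leW_mono_in xi_le.
have i0 : 0 \in `[0, 1 : R] by rewrite in_itv/= lexx ler01.
have z01 b : b \in `[0, 1] -> zeta b \in `[0, 1] by exact: zeta01.
have xi0 : xi 0 = 0.
  apply/eqP; rewrite eq_le; apply/andP; split.
    have : xi 0 <= xi (zeta 0).
      by rewrite xi_le ?z01//; have := z01 0 i0; rewrite in_itv/= => /andP[].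
    by rewrite zetaK.
  by have : xi 0 \in `[0, 1] by [exact: xi01]; rewrite in_itv/= => /andP[].
have zeta0 : zeta 0 = 0 by rewrite -[in LHS]xi0 xiK.
split; first exact: z01.
move=> w w01; have [a0|->] := itv01_gt0_or_eq0 a01; last first.
  rewrite zeta0 !level0; congr closure; apply/funext => x /=; apply/propext.
  by rewrite -[X in X < xi _]xi0 xi_lt//.
have za0 : 0 < zeta a.
  by rewrite -xi_lt ?z01// xi0 zetaK.
rewrite !level_pos//; apply/funext => x /=; apply/propext.
by rewrite -{1}(zetaK a a01) xi_le ?z01.
Qed.

Lemma homeo01_id : increasing_homeo01 (@idfun R).
Proof.
have cid : {within `[0, 1], continuous (@idfun R)}.
  by apply: continuous_subspaceT => x; exact: cvg_id.
by split => //; exists idfun; split.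
Qed.

Lemma within_continuous_comp_fun (A : set R) (f g : R -> R) :
  set_fun A A f -> {within A, continuous f} -> {within A, continuous g} ->
  {within A, continuous g \o f}.
Proof.
move=> fA /subspace_continuousP cf /subspace_continuousP cg.
apply/subspace_continuousP => x Ax B /(cg _ (fA _ Ax)).
rewrite /within/= => /(cf x Ax); rewrite /within/=.
move=> near_f.
have : \forall y \near x, A y -> A (f y) -> B (g (f y)) by exact: near_f.
by apply: filterS => y h Ay; exact: h Ay (fA _ Ay).
Qed.

Lemma homeo01_comp xi xi' : increasing_homeo01 xi -> increasing_homeo01 xi' ->
  increasing_homeo01 (xi \o xi').
Proof.
move=> [xi01 xiM cxi [zeta [zeta01 czeta xiK zetaK]]].
move=> [xi01' xiM' cxi' [zeta' [zeta01' czeta' xiK' zetaK']]].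
split.
- by move=> a /xi01'/xi01.
- by move=> a b a01 b01 ab; apply: xiM; [exact: xi01'|exact: xi01'|exact: xiM'].
- exact: within_continuous_comp_fun.
exists (zeta' \o zeta); split.
- by move=> a /zeta01/zeta01'.
- exact: within_continuous_comp_fun.
- by move=> a a01 /=; rewrite xiK ?xiK'//; exact: xi01'.
- by move=> a a01 /=; rewrite zetaK' ?zetaK//; exact: zeta01.
Qed.

End homeomorphisms.

(** * The metrics on fuzzy sets *)

Section fuzzy_metrics.
Context {R : realType} {X : metricType R}.
Implicit Types (u v w : normal_fuzzy X) (xi : R -> R) (e : R).

Lemma d_infty_leP (u v : X -> R) e : (d_infty u v <= e%:E)%E <->
  forall a, a \in `[0, 1] ->
    (hausdorff_dist mdist (level u a) (level v a) <= e%:E)%E.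
Proof.
split=> [/ereal_supP sup_le a a01|le_e]; first by apply: sup_le; exists a.
by apply/ereal_supP => _ [a a01 <-]; exact: le_e.
Qed.

Lemma prod_dist_refl (p : X * R) : prod_dist p p <= 0.
Proof. by rewrite /prod_dist mdistxx subrr normr0 maxxx. Qed.

Lemma prod_dist_triangle (p q s : X * R) :
  prod_dist p s <= prod_dist p q + prod_dist q s.
Proof.
rewrite /prod_dist ge_max; apply/andP; split.
  apply: le_trans (metric_triangle p.1 q.1 s.1) _.
  by apply: lerD; rewrite le_max lexx.
apply: le_trans (ler_distD q.2 _ _) _.
by apply: lerD; rewrite le_max lexx orbT.
Qed.

Lemma d_infty_refl (u : X -> R) : (d_infty u u <= 0%:E)%E.
Proof.
apply/d_infty_leP => a _; apply: hausdorff_dist_refl => x.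
by rewrite mdistxx.
Qed.

Lemma d_infty_triangle (u v w : X -> R) a b :
  (d_infty u v <= a%:E -> d_infty v w <= b%:E ->
   d_infty u w <= (a + b)%:E)%E.
Proof.
move=> /d_infty_leP uv /d_infty_leP vw; apply/d_infty_leP => c c01.
by apply: hausdorff_dist_triangle (uv c c01) (vw c c01); exact: metric_triangle.
Qed.

(** The levels of [xi \o v] and [xi \o w] are those of [v] and [w] in the same
    new order, so the supremum over all heights does not grow. *)
Lemma d_infty_homeo01 xi (v w : X -> R) e : increasing_homeo01 xi ->
  (forall x, v x \in `[0, 1]) -> (forall x, w x \in `[0, 1]) ->
  (d_infty v w <= e%:E -> d_infty (xi \o v) (xi \o w) <= e%:E)%E.
Proof.
move=> /(homeo01_level (X := X))[zeta levelE] v01 w01 /d_infty_leP vw.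
apply/d_infty_leP => a /levelE[za01 level_xi].
by rewrite !level_xi//; exact: vw.
Qed.

Lemma d_skorokhod_le_d_infty u v e : 0 < e ->
  (d_infty u v <= e%:E -> d_skorokhod u v <= e%:E)%E.
Proof.
move=> e0 uv; apply: ge_ereal_inf; exists e%:E => //; exists e => //.
split => //; exists idfun; split => //; first exact: homeo01_id.
apply/ereal_supP => _ [a _ <-]; rewrite subrr normr0 lee_fin; exact: ltW.
Qed.

Lemma d_skorokhod_refl u : (d_skorokhod u u <= 0%:E)%E.
Proof.
apply/lee_addgt0Pr => e e0; rewrite add0e; apply: d_skorokhod_le_d_infty => //.
apply: le_trans (d_infty_refl u) _; rewrite lee_fin; exact: ltW.
Qed.

(** Time changes are composed, and their displacements add up; the outer one is
    removed from the second distance by [d_infty_homeo01]. *)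
Lemma d_skorokhod_triangle u v w a b :
  (d_skorokhod u v <= a%:E -> d_skorokhod v w <= b%:E ->
   d_skorokhod u w <= (a + b)%:E)%E.
Proof.
move=> uva vwb; apply/lee_addgt0Pr => h h0; have h20 : 0 < h / 2 by rewrite divr_gt0.
have [|_ [s [s0 [xi [hxi /ereal_supP xis uvs]] <-]]] :=
    @ereal_inf_lt _ _ (a + h / 2)%:E (le_lt_trans uva _).
  by rewrite lte_fin ltrDl.
rewrite lte_fin => sa.
have [|_ [t [t0 [zeta [hzeta /ereal_supP zetat vwt]] <-]]] :=
    @ereal_inf_lt _ _ (b + h / 2)%:E (le_lt_trans vwb _).
  by rewrite lte_fin ltrDl.
rewrite lte_fin => tb.
apply: ge_ereal_inf; exists (s + t)%:E; last first.
  by rewrite -EFinD lee_fin [h in leRHS]splitr addrACA ltW// ltrD.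
exists (s + t) => //; split; first exact: addr_gt0.
have [zeta01 _ _ _] := hzeta.
exists (xi \o zeta); split; first exact: homeo01_comp.
  apply/ereal_supP => _ [c c01 <-]; rewrite lee_fin /=.
  apply: le_trans (ler_distD (zeta c) _ _) _; apply: lerD.
    by rewrite -lee_fin; apply: xis; exists (zeta c) => //; exact: zeta01.
  by rewrite -lee_fin; apply: zetat; exists c.
apply: d_infty_triangle uvs _.
apply: d_infty_homeo01 vwt => // x; first exact: fuzzy_itv.
by apply: zeta01; exact: fuzzy_itv.
Qed.

(** A point of a graph is matched with one at the same height, taken in the level
    of the other fuzzy set at that height. *)
Lemma d_sendograph_le_d_infty u v e :
  (d_infty u v <= e%:E -> d_sendograph u v <= e%:E)%E.
Proof.
move=> /d_infty_leP uv; rewrite /d_sendograph !sendographE.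
have half (s t : normal_fuzzy X) :
    (forall a, a \in `[0, 1] -> in_neighborhood mdist e (level s a) (level t a)) ->
    in_neighborhood prod_dist e [set p | p.2 \in `[0, 1] /\ level s p.2 p.1]
      [set p | p.2 \in `[0, 1] /\ level t p.2 p.1].
  move=> st [x a] /= [a01 sax] e' ee'.
  have [y tay dxy] := st a a01 x sax e' ee'; exists (y, a) => //.
  rewrite /prod_dist/= subrr normr0 gt_max dxy.
  exact: le_lt_trans (mdist_ge0 x y) dxy.
by apply/hausdorff_dist_leP; split; apply: half => a /uv /hausdorff_dist_leP[].
Qed.

Lemma d_endograph_le_d_sendograph u v e : 0 <= e ->
  (d_sendograph u v <= e%:E -> d_endograph u v <= e%:E)%E.
Proof.
move=> e0; rewrite /d_endograph !endographE; apply: hausdorff_dist_setU => //.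
exact: prod_dist_refl.
Qed.

End fuzzy_metrics.

(** * Dynamics of the Zadeh extension *)

Section zadeh_dynamics.
Context {R : realType} {X : metricType R}.
Variables (f : X -> X) (cf : continuous f).
Implicit Types (u v : normal_fuzzy X) (e : R).

Hypothesis f_nonexpansive : forall x y, mdist (f x) (f y) <= mdist x y.

Lemma sendograph_zadeh u :
  sendograph (zadeh cf u) = (fun p => (f p.1, p.2)) @` sendograph u.
Proof.
rewrite !sendographE; apply/seteqP; split=> [[x a]/= [a01]|_ [[y a]/= [a01 uay] <-]].
  by rewrite level_zadeh// => -[y uay <-]; exists (y, a).
by split => //=; rewrite level_zadeh//; exists y.
Qed.

(** The floor is added back because [f] need not be surjective: the image of the
    floor is only [f(X) * {0}]. *)
Lemma endograph_zadeh u : endograph (zadeh cf u) =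
  ((fun p => (f p.1, p.2)) @` endograph u) `|` [set p | p.2 = 0].
Proof.
rewrite !endographE sendograph_zadeh image_setU -setUA; congr (_ `|` _).
by rewrite setUidr// => _ [p p0 <-].
Qed.

(** A time change admissible for [u] and [v] is admissible, with the same bound,
    for their images: relabelling levels commutes with taking their images. *)
Lemma zadeh_d_skorokhod u v :
  (d_skorokhod (zadeh cf u) (zadeh cf v) <= d_skorokhod u v)%E.
Proof.
apply: le_ereal_inf => _ [s [s0 [xi [hxi xis uvs]] <-]].
exists s => //; split => //; exists xi; split => //.
have [zeta levelE] := homeo01_level (X := X) hxi.
move/d_infty_leP : uvs => uvs; apply/d_infty_leP => a a01.
have [za01 level_xi] := levelE a a01; move: (uvs a a01).
rewrite !level_xi ?level_zadeh//; last 2 first.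
- by move=> x; exact: fuzzy_itv.
- by move=> x; exact: fuzzy_itv.
exact: hausdorff_dist_image.
Qed.

Lemma prod_dist_nonexpansive (p q : X * R) :
  prod_dist (f p.1, p.2) (f q.1, q.2) <= prod_dist p q.
Proof. by rewrite /prod_dist/= ge_max !le_max f_nonexpansive lexx orbT. Qed.

Lemma zadeh_d_sendograph u v e :
  (d_sendograph u v <= e%:E -> d_sendograph (zadeh cf u) (zadeh cf v) <= e%:E)%E.
Proof.
rewrite /d_sendograph !sendograph_zadeh; apply: hausdorff_dist_image.
exact: prod_dist_nonexpansive.
Qed.

Lemma zadeh_d_endograph u v e : 0 <= e ->
  (d_endograph u v <= e%:E -> d_endograph (zadeh cf u) (zadeh cf v) <= e%:E)%E.
Proof.
move=> e0 uv; rewrite /d_endograph !endograph_zadeh.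
apply: hausdorff_dist_setU => //; first exact: prod_dist_refl.
by apply: hausdorff_dist_image uv; exact: prod_dist_nonexpansive.
Qed.

(** Corresponding levels of the two images are nonempty subsets of [f^n(X)]. *)
Lemma d_infty_iter_zadeh n e u v :
  (forall x y, mdist (iter n f x) (iter n f y) <= e) ->
  (d_infty (iter n (zadeh cf) u) (iter n (zadeh cf) v) <= e%:E)%E.
Proof.
move=> diam; apply/d_infty_leP => a a01; rewrite !level_iter_zadeh//.
have half (s t : normal_fuzzy X) : in_neighborhood mdist e
    (iter n f @` level s a) (iter n f @` level t a).
  move=> _ [x _ <-] e' ee'; have [y ty] := level_neq0 t _ a01.
  by exists (iter n f y); [exists y|exact: le_lt_trans (diam x y) ee'].
by apply/hausdorff_dist_leP; split.
Qed.

(** Small diameter is inherited by all metrics from [d_infty], the finest one. *)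
Lemma zadeh_shadowing :
  (forall eps : R, 0 < eps ->
    exists N, forall x y, mdist (iter N f x) (iter N f y) <= eps) ->
  [/\ shadowing_property (fun u v => d_skorokhod u v) (zadeh cf),
      shadowing_property (fun u v => d_sendograph u v) (zadeh cf) &
      shadowing_property (fun u v => d_endograph u v) (zadeh cf)].
Proof.
move=> diam; split; apply: shadowing_of_vanishing_diameter => /=.
- exact: d_skorokhod_refl.
- exact: d_skorokhod_triangle.
- by move=> u v a _; apply: le_trans; exact: zadeh_d_skorokhod.
- move=> eps eps0; have [N diamN] := diam eps eps0; exists N => u v.
  by apply: d_skorokhod_le_d_infty => //; exact: d_infty_iter_zadeh.
- by move=> u; apply: hausdorff_dist_refl; exact: prod_dist_refl.
- move=> u v w a b; apply: hausdorff_dist_triangle; exact: prod_dist_triangle.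
- by move=> u v a _; exact: zadeh_d_sendograph.
- move=> eps eps0; have [N diamN] := diam eps eps0; exists N => u v.
  by apply: d_sendograph_le_d_infty; exact: d_infty_iter_zadeh.
- by move=> u; apply: hausdorff_dist_refl; exact: prod_dist_refl.
- move=> u v w a b; apply: hausdorff_dist_triangle; exact: prod_dist_triangle.
- by move=> u v a; exact: zadeh_d_endograph.
- move=> eps eps0; have [N diamN] := diam eps eps0; exists N => u v.
  apply: d_endograph_le_d_sendograph; first exact: ltW.
  by apply: d_sendograph_le_d_infty; exact: d_infty_iter_zadeh.
Qed.

End zadeh_dynamics.

(** If [M] bounds the diameter of [f^k(X)] and [lambda] is the contraction ratio,
    then [M * lambda ^+ n] bounds that of [f^(n+k)(X)]. *)
Lemma contractive_vanishing_diameter (R : realType) (X : metricType R)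
    (f : X -> X) (k : nat) (eps : R) :
  contractive f -> metric_bounded (range (iter k f)) -> 0 < eps ->
  exists N, forall x y, mdist (iter N f x) (iter N f y) <= eps.
Proof.
move=> [lambda /andP[l0 l1] flambda] [M diamM] eps0.
have diam n x y : mdist (iter (n + k) f x) (iter (n + k) f y) <= M * lambda ^+ n.
  elim: n => [|n IHn]; first by rewrite mulr1; apply: diamM; eexists.
  rewrite !addSn !iterS exprS mulrCA; apply: le_trans (flambda _ _) _.
  exact: ler_wpM2l.
have : M * lambda ^+ n @[n --> \oo] --> 0.
  by apply: (@cvg_geometric _ M lambda); rewrite ger0_norm.
move=> /cvgrPdist_le/(_ _ eps0)[n _ /(_ n (leqnn n))].
rewrite /= sub0r normrN => Mn; exists (n + k)%N => x y.
exact: le_trans (diam n x y) (le_trans (ler_norm _) Mn).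
Qed.

Theorem theorem5p6 (R : realType) (X : metricType R) (f : X -> X)
    (cf : continuous f) :
  ((contractive f /\
    exists2 k : nat, (0 < k)%N & metric_bounded (range (iter k f))) ->
   [/\ shadowing_property (fun u v : normal_fuzzy X => d_skorokhod u v)
         (zadeh cf),
       shadowing_property (fun u v : normal_fuzzy X => d_sendograph u v)
         (zadeh cf) &
       shadowing_property (fun u v : normal_fuzzy X => d_endograph u v)
         (zadeh cf)])
  /\
  ((contractive f /\ metric_bounded [set: X]) ->
   [/\ shadowing_property (fun u v : normal_fuzzy X => d_skorokhod u v)
         (zadeh cf),
       shadowing_property (fun u v : normal_fuzzy X => d_sendograph u v)
         (zadeh cf) &
       shadowing_property (fun u v : normal_fuzzy X => d_endograph u v)
         (zadeh cf)]).
Proof.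
have main k : contractive f -> metric_bounded (range (iter k f)) ->
    [/\ shadowing_property (fun u v : normal_fuzzy X => d_skorokhod u v)
          (zadeh cf),
        shadowing_property (fun u v : normal_fuzzy X => d_sendograph u v)
          (zadeh cf) &
        shadowing_property (fun u v : normal_fuzzy X => d_endograph u v)
          (zadeh cf)].
  move=> fC bnd; apply: zadeh_shadowing => [x y|eps eps0].
    have [lambda /andP[_ l1] flambda] := fC.
    apply: le_trans (flambda x y) _.
    by rewrite ler_piMl ?mdist_ge0// ltW.
  exact: contractive_vanishing_diameter fC bnd eps0.
split=> [[fC [k _ bnd]]|[fC [M diamM]]]; first exact: main k fC bnd.
(* A bounded [X] is the range of the 0-th iterate. *)
by apply: (main 0%N) => //; exists M => x y _ _; exact: diamM.
Qed.
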